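(* (i) The base curve $\alpha$ is a geodesic on the GNR-surface $F_{(\alpha,q_n)}$ if and only if $\alpha$ is a straight line or $F_{(\alpha,q_n)}=F_{(\alpha,B)}$. (ii) The base curve $\alpha$ is an asymptotic curve on $F_{(\alpha,q_n)}$ if and only if $\alpha$ is a straight line or $F_{(\alpha,q_n)}=F_{(\alpha,N)}$.
   Context: Let $I\subset\mathbb{R}$ be an open interval and $\alpha:I\to\mathbb{R}^3$ a smooth unit speed curve with arclength parameter $s$, positively oriented orthonormal Frenet frame $\{\vec T,\vec N,\vec B\}$, curvature $\kappa$ and torsion $\tau$: $\vec T=\vec\alpha'$, $\vec T'=\kappa\vec N$, $\vec N'=-\kappa\vec T+\tau\vec B$, $\vec B'=-\tau\vec N$ (prime is $d/ds$). Convention: either $\kappa>0$ on $I$, or $\alpha$ is a straight line, in which case $\kappa=\tau=0$ and $\vec N,\vec B$ are chosen constant. Let $a_1,a_2:I\to\mathbb{R}$ be smooth with $a_1^2+a_2^2=1$. The generalized normal ruled surface (GNR-surface) of $\alpha$ is $\vec F_{(\alpha,q_n)}(s,u)=\vec\alpha(s)+u\,\vec q_n(s)$, $(s,u)\in I\times\mathbb{R}$, with $\vec q_n=a_1\vec N+a_2\vec B$. $F_{(\alpha,q_n)}=F_{(\alpha,B)}$ (the binormal surface) means $a_1\equiv0$, $a_2\equiv\pm1$; $F_{(\alpha,q_n)}=F_{(\alpha,N)}$ (the principal normal surface) means $a_1\equiv\pm1$, $a_2\equiv0$. The unit surface normal along $\alpha$ (i.e. at $u=0$) is $\vec U_\alpha=-a_2\vec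 N+a_1\vec B$. The curve $\alpha$ is a geodesic on the surface if $\vec U_\alpha\times\vec\alpha''=0$ on $I$, and an asymptotic curve if $\langle\vec U_\alpha,\vec\alpha''\rangle=0$ on $I$. *)

(* Defs.v *)
From HB Require Import structures.
From mathcomp Require Import all_boot all_order all_algebra.
From mathcomp Require Import all_classical all_reals all_analysis.
From mathcomp Require Import ring lra.

Set Implicit Arguments.
Unset Strict Implicit.
Unset Printing Implicit Defensive.

Import Order.TTheory GRing.Theory Num.Theory.
Import numFieldNormedType.Exports.

Local Open Scope classical_set_scope.
Local Open Scope ring_scope.

(* The norm `|u| of the library on row vectors is the sup norm, hence the
   Euclidean structure of R^3 is defined here. *)
Definition dotv (R : realType) (u v : 'rV[R]_3) : R := (u *m v^T) 0 0.

(* Indices are added in 'I_3, i.e. modulo 3. *)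
Definition crossv (R : realType) (u v : 'rV[R]_3) : 'rV[R]_3 :=
  \row_(i < 3) (u 0 (i + 1) * v 0 (i + 2) - u 0 (i + 2) * v 0 (i + 1)).

Definition enorm (R : realType) (u : 'rV[R]_3) : R := Num.sqrt (dotv u u).

Definition frame_mx (R : realType) (u v w : 'rV[R]_3) : 'M[R]_3 :=
  \matrix_(i < 3) [:: u; v; w]`_i.

Definition pos_orthonormal (R : realType) (u v w : 'rV[R]_3) : Prop :=
  frame_mx u v w *m (frame_mx u v w)^T = 1%:M /\ 0 < \det (frame_mx u v w).

(* Maps on I are represented by total functions; as I is open, the iterated
   derivatives at the points of I only depend on the restriction to I. *)
Definition smooth_on (R : realType) (V : normedModType R) (I : set R)
  (f : R -> V) : Prop := forall (n : nat) (s : R), I s -> derivable (derive1n n f) s 1.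

Definition straight_line (R : realType) (I : set R) (alpha : R -> 'rV[R]_3) :
  Prop := exists p v : 'rV[R]_3,
    v != 0 /\ alpha @` I `<=` [set x | exists t : R, x = p + t *: v].

Record frenet_curve (R : realType) (I : set R) (alpha T N B : R -> 'rV[R]_3)
    (kappa tau : R -> R) : Prop := FrenetCurve {
  frenet_smooth : smooth_on I alpha ;
  frenet_frame : forall s, I s -> pos_orthonormal (T s) (N s) (B s) ;
  frenet_alpha : forall s, I s -> is_derive s 1 alpha (T s) ;
  frenet_T : forall s, I s -> is_derive s 1 T (kappa s *: N s) ;
  frenet_N : forall s, I s ->
    is_derive s 1 N (- kappa s *: T s + tau s *: B s) ;
  frenet_B : forall s, I s -> is_derive s 1 B (- tau s *: N s) ;
  frenet_convention :
    (forall s, I s -> 0 < kappa s) \/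
    [/\ straight_line I alpha,
        forall s, I s -> kappa s = 0 /\ tau s = 0 &
        exists N0 B0 : 'rV[R]_3, forall s, I s -> N s = N0 /\ B s = B0] }.

Definition gnr_ruling (R : realType) (N B : R -> 'rV[R]_3) (a1 a2 : R -> R)
  (s : R) : 'rV[R]_3 := a1 s *: N s + a2 s *: B s.

Definition gnr_surface (R : realType) (alpha N B : R -> 'rV[R]_3)
  (a1 a2 : R -> R) (s u : R) : 'rV[R]_3 := alpha s + u *: gnr_ruling N B a1 a2 s.

Definition unit_normal (R : realType) (F : R -> R -> 'rV[R]_3) (s u : R) :
    'rV[R]_3 :=
  let n := crossv (derive1 (fun t => F t u) s) (derive1 (F s) u) in (enorm n)^-1 *: n.

Definition base_normal (R : realType) (F : R -> R -> 'rV[R]_3) (s : R) :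
  'rV[R]_3 := unit_normal F s 0.

Definition base_geodesic (R : realType) (I : set R) (F : R -> R -> 'rV[R]_3)
    (alpha : R -> 'rV[R]_3) : Prop :=
  forall s, I s -> crossv (base_normal F s) (derive1n 2 alpha s) = 0.

Definition base_asymptotic (R : realType) (I : set R) (F : R -> R -> 'rV[R]_3)
    (alpha : R -> 'rV[R]_3) : Prop :=
  forall s, I s -> dotv (base_normal F s) (derive1n 2 alpha s) = 0.

Definition is_binormal_surface (R : realType) (I : set R) (a1 a2 : R -> R) :
    Prop :=
  (forall s, I s -> a1 s = 0) /\
  ((forall s, I s -> a2 s = 1) \/ (forall s, I s -> a2 s = -1)).

Definition is_principal_normal_surface (R : realType) (I : set R)
    (a1 a2 : R -> R) : Prop :=
  ((forall s, I s -> a1 s = 1) \/ (forall s, I s -> a1 s = -1)) /\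
  (forall s, I s -> a2 s = 0).

Lemma dotvE (R : realType) (u v : 'rV[R]_3) :
  dotv u v = u 0 0 * v 0 0 + u 0 1 * v 0 1 + u 0 2 * v 0 2.
Proof.
rewrite /dotv mxE !big_ord_recl big_ord0 !mxE addr0 addrA.
by congr (_ + _ * _ + _ * _); congr (_ _ _); apply: val_inj.
Qed.

Lemma crossvE (R : realType) (u v : 'rV[R]_3) :
  (crossv u v 0 0 = u 0 1 * v 0 2 - u 0 2 * v 0 1) *
  (crossv u v 0 1 = u 0 2 * v 0 0 - u 0 0 * v 0 2) *
  (crossv u v 0 2 = u 0 0 * v 0 1 - u 0 1 * v 0 0).
Proof.
by do 2?split; rewrite mxE; congr (_ * _ - _ * _);
  congr (_ _ _); apply: val_inj.
Qed.

Lemma rV3P (R : realType) (u v : 'rV[R]_3) :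
  u 0 0 = v 0 0 -> u 0 1 = v 0 1 -> u 0 2 = v 0 2 -> u = v.
Proof.
move=> h0 h1 h2; apply/rowP => -[[|[|[|//]]] i].
- by rewrite (_ : Ordinal i = 0) //; apply: val_inj.
- by rewrite (_ : Ordinal i = 1) //; apply: val_inj.
- by rewrite (_ : Ordinal i = 2) //; apply: val_inj.
Qed.

Lemma det_frame_mx (R : realType) (u v w : 'rV[R]_3) :
  \det (frame_mx u v w) = dotv (crossv u v) w.
Proof.
rewrite (expand_det_row _ 0) !big_ord_recl big_ord0 addr0 /cofactor.
rewrite !(expand_det_row _ 0) !big_ord_recl !big_ord0 !addr0 /cofactor !det_mx11.
rewrite !mxE /= dotvE !crossvE.
pose c (x : 'rV[R]_3) (n : nat) := x 0 (inord n).
have cE (x : 'rV[R]_3) (i : 'I_3) : x 0 i = c x (val i) by rewrite /c inord_val.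
by clearbody c; rewrite !cE /= /bump /=; ring.
Qed.

Lemma dotvv_eq0 (R : realType) (u : 'rV[R]_3) : dotv u u = 0 -> u = 0.
Proof.
rewrite dotvE => h.
have sq (x y z : R) : x * x + y * y + z * z = 0 -> x = 0.
  move=> xyz; apply/eqP; rewrite -sqrf_eq0; apply/eqP/le_anti.
  by rewrite sqr_ge0 andbT; nra.
apply: rV3P; rewrite !mxE.
- exact: sq h.
- by apply: (sq _ (u 0 0) (u 0 2)); rewrite -h; ring.
- by apply: (sq _ (u 0 0) (u 0 1)); rewrite -h; ring.
Qed.

Lemma pos_orthonormalP (R : realType) (u v w : 'rV[R]_3) :
  pos_orthonormal u v w ->
  [/\ dotv u u = 1, dotv v v = 1, dotv w w = 1 &
      [/\ dotv u v = 0, dotv u w = 0, dotv v w = 0 & crossv u v = w]].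
Proof.
case=> AAT detA.
have dotA (i j : 'I_3) : dotv [:: u; v; w]`_i [:: u; v; w]`_j = ((i == j :> 'I_3)%:R : R).
  have := congr1 (fun M : 'M[R]_3 => M i j) AAT.
  rewrite /dotv !mxE => <-.
  by apply: eq_bigr => k _; rewrite !mxE.
have uu := dotA 0 0; have vv := dotA 1 1; have ww := dotA 2 2.
have uv := dotA 0 1; have uw := dotA 0 2; have vw := dotA 1 2.
rewrite /= in uu vv ww uv uw vw.
split=> //; split=> //.
have det1 : \det (frame_mx u v w) = 1.
  have := congr1 (@determinant R 3) AAT.
  rewrite det_mulmx det_tr det1 -expr2 => /eqP.
  by rewrite sqrf_eq1 => /orP[/eqP//|/eqP d]; move: detA; rewrite d; lra.
move: det1; rewrite det_frame_mx => det1.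
apply/eqP; rewrite -subr_eq0; apply/eqP/dotvv_eq0.
have -> : dotv (crossv u v - w) (crossv u v - w) =
  dotv u u * dotv v v - dotv u v ^+ 2 - dotv (crossv u v) w *+ 2 + dotv w w.
  have cE i : (crossv u v - w) 0 i = crossv u v 0 i - w 0 i.
    by move: (crossv u v) => c; rewrite !mxE.
  by rewrite !dotvE !cE !crossvE; ring.
by rewrite uu vv uv det1 ww; ring.
Qed.

(* On the base curve the unit normal of the surface is -a2 N + a1 B. *)
Lemma base_normal_gnr (R : realType) (I : set R) (alpha T N B : R -> 'rV[R]_3)
    (kappa tau a1 a2 : R -> R) (s : R) :
  frenet_curve I alpha T N B kappa tau -> I s -> a1 s ^+ 2 + a2 s ^+ 2 = 1 ->
  base_normal (gnr_surface alpha N B a1 a2) s = - a2 s *: N s + a1 s *: B s.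
Proof.
move=> fr Is a12.
have [uu vv ww [uv uw vw TNB]] := pos_orthonormalP (frenet_frame fr Is).
rewrite /base_normal /unit_normal.
have -> : derive1 (fun t => gnr_surface alpha N B a1 a2 t 0) s = T s.
  rewrite (_ : (fun t => _) = alpha); last first.
    by apply/funext => t; rewrite /gnr_surface scale0r addr0.
  by rewrite derive1E; have := frenet_alpha fr Is => /@derive_val ->.
set q := gnr_ruling N B a1 a2 s.
have -> : derive1 (gnr_surface alpha N B a1 a2 s) 0 = q.
  rewrite derive1E /derive; apply/cvg_lim => //.
  apply: (@cvg_trans _ (cst q @ 0^')); last exact: cvg_cst.
  apply: near_eq_cvg; near=> h.
  have h0 : h != 0 by near: h; exact: nbhs_dnbhs_neq.
  rewrite /gnr_surface -/q /= scale0r !addr0 [h *: 1]mulr1 [alpha s + _]addrC.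
  by rewrite addrK scalerA mulVf // scale1r.
have TBN : crossv (T s) (B s) = - N s.
  have -> : crossv (T s) (B s) =
      dotv (T s) (N s) *: T s - dotv (T s) (T s) *: N s.
    by rewrite -TNB; apply: rV3P; rewrite !crossvE !dotvE !mxE; ring.
  by rewrite uv uu scale0r scale1r sub0r.
have -> : crossv (T s) q = - a2 s *: N s + a1 s *: B s.
  have -> : crossv (T s) q =
      a1 s *: crossv (T s) (N s) + a2 s *: crossv (T s) (B s).
    have cE (x y : 'rV[R]_3) i :
        (a1 s *: x + a2 s *: y) 0 i = a1 s * x 0 i + a2 s * y 0 i.
      by rewrite !mxE.
    by apply: rV3P; rewrite cE !crossvE !cE; ring.
  by rewrite TNB TBN scalerN scaleNr addrC.
rewrite /enorm; have -> : dotv (- a2 s *: N s + a1 s *: B s)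
    (- a2 s *: N s + a1 s *: B s) = a2 s ^+ 2 * dotv (N s) (N s)
    - a1 s * a2 s * dotv (N s) (B s) *+ 2 + a1 s ^+ 2 * dotv (B s) (B s).
  by rewrite !dotvE !mxE; ring.
rewrite vv ww vw !mulr1 mulr0 mul0rn subr0 addrC a12.
by rewrite sqrtr1 invr1 scale1r.
Unshelve. all: by end_near. Qed.

(* Main.v *)
Require Import Defs.
From mathcomp Require Import all_boot all_order all_algebra.
From mathcomp Require Import all_classical all_reals all_analysis.
From mathcomp Require Import ring.

Set Implicit Arguments.
Unset Strict Implicit.
Unset Printing Implicit Defensive.

Import Order.TTheory GRing.Theory Num.Theory.
Import numFieldNormedType.Exports.
Local Open Scope classical_set_scope.
Local Open Scope ring_scope.

(** On the base curve the surface normal is - a2 N + a1 B and the acceleration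
    is kappa N.  Their cross product is therefore - kappa a1 T and their scalar
    product is - kappa a2 ([geodesic_at], [asymptotic_at]), so that the geodesic
    condition reads kappa a1 = 0 and the asymptotic one kappa a2 = 0 on I.

    Whether a product kappa a vanishes identically is settled by the convention
    on Frenet curves: the curvature is either nowhere zero, which forces a = 0,
    or the curve is a line ([curvature_eq0_or]).  Conversely a line has zero
    curvature for any Frenet frame ([frenet_line_curvature0]): its tangent, and
    then the derivative kappa N of its tangent, stay parallel to the line, while
    T and N are linearly independent.

    Once one of the coefficients a1, a2 vanishes on I, the other has square 1,
    and being continuous on an interval it is constantly 1 or constantly -1
    ([unit_square_constant_sign]). *)

Lemma dotvDl (R : realType) (u v w : 'rV[R]_3) :
  dotv (u + v) w = dotv u w + dotv v w.
Proof. by rewrite /dotv mulmxDl mxE. Qed.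

Lemma dotvDr (R : realType) (u v w : 'rV[R]_3) :
  dotv w (u + v) = dotv w u + dotv w v.
Proof. by rewrite /dotv linearD mulmxDr mxE. Qed.

Lemma dotvZl (R : realType) (k : R) (u v : 'rV[R]_3) :
  dotv (k *: u) v = k * dotv u v.
Proof. by rewrite /dotv -scalemxAl mxE. Qed.

Lemma dotvZr (R : realType) (k : R) (u v : 'rV[R]_3) :
  dotv u (k *: v) = k * dotv u v.
Proof. by rewrite /dotv linearZ -scalemxAr mxE. Qed.

Lemma dotvC (R : realType) (u v : 'rV[R]_3) : dotv u v = dotv v u.
Proof. by rewrite !dotvE; ring. Qed.

Lemma is_derive_dotv (R : realType) (w : 'rV[R]_3) (f : R -> 'rV[R]_3)
    (df : 'rV[R]_3) (s : R) :
  is_derive s 1 f df -> is_derive s 1 (fun t => dotv w (f t)) (dotv w df).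
Proof.
case=> f_ex f_val.
have dcoord (i : 'I_3) : is_derive s 1 (fun t => f t 0 i) (df 0 i).
  apply: DeriveDef; first exact: (derivable_mxP _ _ _).1 f_ex 0 i.
  by rewrite -f_val derive_mx // mxE.
rewrite (_ : (fun t => _) = (w 0 0 \*: (fun t => f t 0 0)) +
  (w 0 1 \*: (fun t => f t 0 1)) + (w 0 2 \*: (fun t => f t 0 2))); last first.
  by apply/funext => t; rewrite dotvE.
by apply: is_derive_eq; rewrite dotvE.
Qed.

(** Used on t |-> <w, f t>: a curve confined to a hyperplane with normal w has its
    derivative orthogonal to w. *)
Lemma is_derive_near_cst (R : realType) (V : normedModType R) (f : R -> V)
    (c df : V) (s : R) :
  is_derive s 1 f df -> (\near s, f s = c) -> df = 0.
Proof.
move=> /[swap] fc /(near_eq_is_derive fc) /@derive_val <-.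
exact: derive_cst.
Qed.

(** The two values 1 and -1 cannot both be taken, since by the intermediate value
    theorem f would then vanish in between. *)
Lemma unit_square_constant_sign (R : realType) (I : set R) (f : R -> R) :
  is_interval I -> (forall s, I s -> {for s, continuous f}) ->
  (forall s, I s -> f s ^+ 2 = 1) ->
  (forall s, I s -> f s = 1) \/ (forall s, I s -> f s = -1).
Proof.
move=> itvI fC f1.
have pm s : I s -> f s = 1 \/ f s = -1.
  move=> /f1 /eqP; rewrite sqrf_eq1 => /orP[/eqP|/eqP]; by [left|right].
have same s t : I s -> I t -> s <= t -> f s = f t.
  move=> Is It st.
  have sub c : c \in `[s, t] -> I c.
    by rewrite in_itv => /= sct; apply: (itvI s t).
  have cont : {within `[s, t], continuous f}.
    by apply: continuous_in_subspaceT => c /[!inE] /sub /fC.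
  have no0 : ~ (Num.min (f s) (f t) <= 0 <= Num.max (f s) (f t)).
    move=> /(IVT st cont)[c /sub /f1 + fc0].
    by rewrite fc0 expr0n /= => /eqP; rewrite eq_sym oner_eq0.
  case: (pm s Is) (pm t It) => -> [] -> // in no0 *; case: no0.
    by rewrite ge_min le_max ler01 lerN10 orbT.
  by rewrite ge_min le_max ler01 lerN10 orbT.
have [[s0 [Is0 fs0]]|no] := pselect (exists s, I s /\ f s = 1).
  left=> t It; case: (leP s0 t) => [|/ltW] st.
    by rewrite -(same _ _ Is0 It st).
  by rewrite (same _ _ It Is0 st).
by right=> t It; case: (pm t It) => // ft; case: no; exists t.
Qed.

(** Openness of I makes alpha' agree with T on a neighbourhood of s, which is
    what differentiating once more requires. *)
Lemma frenet_derive2 (R : realType) (I : set R) (alpha T N B : R -> 'rV[R]_3)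
    (kappa tau : R -> R) (s : R) :
  open I -> frenet_curve I alpha T N B kappa tau -> I s ->
  derive1n 2 alpha s = kappa s *: N s.
Proof.
move=> oI fr Is; rewrite /= derive1E.
suff dT : is_derive s 1 (derive1 alpha) (kappa s *: N s) by rewrite derive_val.
apply: near_eq_is_derive (frenet_T fr Is).
near=> t; rewrite derive1E.
have It : I t by near: t; exact: open_nbhs_nbhs.
by have := frenet_alpha fr It => /@derive_val ->.
Unshelve. all: by end_near. Qed.

(** Every w orthogonal to the direction v of the line is orthogonal to alpha' = T
    and to T' = kappa N.  Taking w = <N, v> T - <T, v> N and pairing with T gives
    <N, v> = 0, after which w = N is allowed and gives kappa = 0. *)
Lemma frenet_line_curvature0 (R : realType) (I : set R)
    (alpha T N B : R -> 'rV[R]_3) (kappa tau : R -> R) (s : R) :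
  open I -> frenet_curve I alpha T N B kappa tau -> straight_line I alpha ->
  I s -> kappa s = 0.
Proof.
move=> oI fr [p [v [_ line]]] Is.
have nearI t : I t -> \near t, I t by move=> It; exact: open_nbhs_nbhs.
have Tperp (w : 'rV[R]_3) t : dotv w v = 0 -> I t -> dotv w (T t) = 0.
  move=> wv It; apply: is_derive_near_cst (is_derive_dotv w (frenet_alpha fr It)) _.
  near=> x; have Ix : I x by near: x; exact: nearI.
  have [k ->] := line _ (imageP alpha Ix).
  by rewrite dotvDr dotvZr wv mulr0 addr0.
have Nperp (w : 'rV[R]_3) : dotv w v = 0 -> kappa s * dotv w (N s) = 0.
  move=> wv; rewrite -dotvZr.
  apply: is_derive_near_cst (is_derive_dotv w (frenet_T fr Is)) _.
  by near=> x; apply: Tperp => //; near: x; exact: nearI.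
have [TT NN _ [TN _ _ _]] := pos_orthonormalP (frenet_frame fr Is).
pose w := dotv (N s) v *: T s - dotv (T s) v *: N s.
have wv : dotv w v = 0 by rewrite /w -scaleNr dotvDl !dotvZl; ring.
have Nv : dotv (N s) v = 0.
  have := Tperp w s wv Is.
  by rewrite /w -scaleNr dotvDl !dotvZl (dotvC (N s) (T s)) TT TN mulr1 mulr0 addr0.
by have := Nperp _ Nv; rewrite NN mulr1.
Unshelve. all: by end_near. Qed.

(** Expanding with B = T x N, only the part along B of the normal survives the
    product with N, and B x N = - T. *)
Lemma geodesic_at (R : realType) (I : set R) (alpha T N B : R -> 'rV[R]_3)
    (kappa tau a1 a2 : R -> R) (s : R) :
  open I -> frenet_curve I alpha T N B kappa tau -> I s ->
  a1 s ^+ 2 + a2 s ^+ 2 = 1 ->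
  crossv (base_normal (gnr_surface alpha N B a1 a2) s) (derive1n 2 alpha s) =
  - (kappa s * a1 s) *: T s.
Proof.
move=> oI fr Is a12; rewrite (base_normal_gnr fr Is a12) (frenet_derive2 oI fr Is).
have [_ NN _ [TN _ _ TNB]] := pos_orthonormalP (frenet_frame fr Is).
have cE (x y : 'rV[R]_3) (a b : R) i : (a *: x + b *: y) 0 i = a * x 0 i + b * y 0 i.
  by rewrite !mxE.
have zE (x : 'rV[R]_3) (a : R) i : (a *: x) 0 i = a * x 0 i by rewrite mxE.
(* Lagrange's formula for N x (T x N); the scalar products are kept symbolic
   so that the identity is polynomial in the coordinates. *)
transitivity (- (kappa s * a1 s) *:
    (dotv (N s) (N s) *: T s + (- dotv (T s) (N s)) *: N s)).
  by rewrite -TNB; apply: rV3P;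
    rewrite !crossvE !(cE, zE) !crossvE !dotvE; ring.
by rewrite NN TN scale1r oppr0 scale0r addr0.
Qed.

Lemma asymptotic_at (R : realType) (I : set R) (alpha T N B : R -> 'rV[R]_3)
    (kappa tau a1 a2 : R -> R) (s : R) :
  open I -> frenet_curve I alpha T N B kappa tau -> I s ->
  a1 s ^+ 2 + a2 s ^+ 2 = 1 ->
  dotv (base_normal (gnr_surface alpha N B a1 a2) s) (derive1n 2 alpha s) =
  - (kappa s * a2 s).
Proof.
move=> oI fr Is a12; rewrite (base_normal_gnr fr Is a12) (frenet_derive2 oI fr Is).
have [_ NN _ [_ _ NB _]] := pos_orthonormalP (frenet_frame fr Is).
by rewrite dotvZr dotvDl !dotvZl (dotvC (B s)) NN NB; ring.
Qed.

(** For a = a1 and a = a2 the left-hand side is the geodesic, respectively the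
    asymptotic, condition.  The convention on the frame makes the vanishing of
    the curvature an all-or-nothing matter: without it kappa and a could vanish
    on complementary pieces of I. *)
Lemma curvature_eq0_or (R : realType) (I : set R) (alpha T N B : R -> 'rV[R]_3)
    (kappa tau a : R -> R) :
  open I -> frenet_curve I alpha T N B kappa tau ->
  (forall s, I s -> kappa s * a s = 0) <->
    straight_line I alpha \/ (forall s, I s -> a s = 0).
Proof.
move=> oI fr; split=> [ka0|[line|a0] s Is].
- have [kpos|[line _ _]] := frenet_convention fr; last by left.
  right=> s Is; apply/eqP; have /eqP := ka0 s Is.
  by rewrite mulf_eq0 gt_eqF ?kpos.
- by rewrite (frenet_line_curvature0 oI fr line Is) mul0r.
- by rewrite a0 // mulr0.
Qed.

Lemma unit_pair_constant_sign (R : realType) (I : set R) (a b : R -> R) :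
  is_interval I -> smooth_on I (b : R -> R^o) ->
  (forall s, I s -> a s ^+ 2 + b s ^+ 2 = 1) -> (forall s, I s -> a s = 0) ->
  (forall s, I s -> b s = 1) \/ (forall s, I s -> b s = -1).
Proof.
move=> itvI b_sm ab1 a0; apply: unit_square_constant_sign => // s Is.
  exact/differentiable_continuous/derivable1_diffP/(b_sm 0%N).
by rewrite -(ab1 s Is) a0 // expr0n add0r.
Qed.

Theorem proposition3p8 (R : realType) (I : set R)
    (alpha T N B : R -> 'rV[R]_3) (kappa tau a1 a2 : R -> R) :
  open I -> is_interval I ->
  frenet_curve I alpha T N B kappa tau ->
  smooth_on I (a1 : R -> R^o) -> smooth_on I (a2 : R -> R^o) ->
  (forall s, I s -> a1 s ^+ 2 + a2 s ^+ 2 = 1) ->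
  (base_geodesic I (gnr_surface alpha N B a1 a2) alpha <->
     straight_line I alpha \/ is_binormal_surface I a1 a2) /\
  (base_asymptotic I (gnr_surface alpha N B a1 a2) alpha <->
     straight_line I alpha \/ is_principal_normal_surface I a1 a2).
Proof.
move=> oI itvI fr a1_sm a2_sm a12.
have a21 s : I s -> a2 s ^+ 2 + a1 s ^+ 2 = 1 by move=> Is; rewrite addrC a12.
have geoE : base_geodesic I (gnr_surface alpha N B a1 a2) alpha <->
    forall s, I s -> kappa s * a1 s = 0.
  split=> h s Is; have := h s Is; rewrite (geodesic_at oI fr Is (a12 s Is)).
    have [TT _ _ _] := pos_orthonormalP (frenet_frame fr Is).
    (* T has unit length, so pairing with T reads off its coefficient. *)
    move=> /(congr1 (dotv (T s))); rewrite dotvZr TT mulr1.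
    by rewrite [in RHS]dotvE !mxE !mulr0 !addr0 => /eqP; rewrite oppr_eq0 => /eqP.
  by move=> ->; rewrite oppr0 scale0r.
have asyE : base_asymptotic I (gnr_surface alpha N B a1 a2) alpha <->
    forall s, I s -> kappa s * a2 s = 0.
  split=> h s Is; have := h s Is; rewrite (asymptotic_at oI fr Is (a12 s Is)).
    by move=> /eqP; rewrite oppr_eq0 => /eqP.
  by move=> ->; rewrite oppr0.
split.
- split=> [/geoE/(curvature_eq0_or _ oI fr)[|a10]|line_or].
  + by left.
  + by right; split; last exact: unit_pair_constant_sign itvI a2_sm a12 a10.
  + apply/geoE/(curvature_eq0_or _ oI fr); case: line_or => [|[]]; by [left|right].
- split=> [/asyE/(curvature_eq0_or _ oI fr)[|a20]|line_or].
  + by left.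
  + by right; split; first exact: unit_pair_constant_sign itvI a1_sm a21 a20.
  + apply/asyE/(curvature_eq0_or _ oI fr); case: line_or => [|[]]; by [left|right].
Qed.
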